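(* Let $X$ and $Y$ be Tychonoff spaces. The map $\hat{\chi}\colon \hat{P}(X\times Y)\to \hat{P}(X)\times\hat{P}(Y)$ defined by $\hat{\chi}(\lambda)=(\hat{P}\mathrm{pr}_1(\lambda),\hat{P}\mathrm{pr}_2(\lambda))$ is open, where $\hat{P}(X\times Y)$, $\hat{P}(X)$ and $\hat{P}(Y)$ carry the weak-* topology and $\hat{P}(X)\times\hat{P}(Y)$ carries the product topology.
   Context: For a Tychonoff space $Z$, a finite non-negative Borel measure $\mu$ on $Z$ is Radon if $\mu(A)=\sup\{\mu(K)\colon K\subset A,\ K \text{ compact}\}$ for every Borel set $A\subset Z$. $\hat{P}(Z)$ denotes the set of Radon probability measures on $Z$. The weak-* topology on $\hat{P}(Z)$ is the topology with base consisting of the sets $O(\mu,V_1,\dots,V_k,\varepsilon)=\{\nu\in\hat{P}(Z)\colon \nu(V_i)>\mu(V_i)-\varepsilon,\ i=1,\dots,k\}$, where $\mu\in\hat P(Z)$, $V_1,\dots,V_k\subset Z$ are open and $\varepsilon>0$. $\mathrm{pr}_1\colon X\times Y\to X$ and $\mathrm{pr}_2\colon X\times Y\to Y$ are the coordinate projections, and $\hat{P}\mathrm{pr}_i(\lambda)$ denotes the image (push-forward) measure $\lambda\circ \mathrm{pr}_i^{-1}$, i.e. the marginals of $\lambda$. *)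

(* Defs.v *)
From HB Require Import structures.
From mathcomp Require Import all_boot all_order all_algebra.
From mathcomp Require Import all_classical all_reals all_analysis.
Set Implicit Arguments. Unset Strict Implicit. Unset Printing Implicit Defensive.
Import Order.TTheory GRing.Theory Num.Theory numFieldNormedType.Exports.
Local Open Scope classical_set_scope.
Local Open Scope ring_scope.

Definition tychonoff_space (R : realType) (Z : topologicalType) : Prop :=
  accessible_space Z /\
  forall (a : Z) (B : set Z), closed B -> ~ B a ->
    exists f : Z -> R, [/\ continuous f, (forall z, 0 <= f z <= 1),
                          f a = 0 & forall b, B b -> f b = 1].

Definition borel_set (Z : topologicalType) : set (set Z) := <<s open >>.

Definition borel_sigma_additive (R : realType) (Z : topologicalType)
    (mu : set Z -> \bar R) : Prop :=
  forall F : nat -> set Z, (forall n, borel_set (F n)) -> trivIset setT F ->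
    (fun n => (\sum_(0 <= k < n) mu (F k))%E) @ \oo --> mu (\bigcup_n F n).

(* Radon probability measure on the Borel sets of Z.  A measure is
   represented by a function on all subsets, normalized to be 0 on
   non-Borel sets (so that it is determined by its values on Borel sets). *)
Definition radon_prob (R : realType) (Z : topologicalType)
    (mu : set Z -> \bar R) : Prop :=
  (forall A, ~ borel_set A -> mu A = 0%E) /\
  [/\ (forall A, borel_set A -> (0 <= mu A)%E),
      mu set0 = 0%E,
      borel_sigma_additive mu,
      mu setT = 1%E &
      (forall A, borel_set A ->
         mu A = ereal_sup [set mu K | K in [set K | compact K /\ K `<=` A]])].

Definition Prad (R : realType) (Z : topologicalType) :=
  {mu : set Z -> \bar R | radon_prob mu}.

HB.instance Definition _ (R : realType) (Z : topologicalType) :=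
  gen_eqMixin (Prad R Z).
HB.instance Definition _ (R : realType) (Z : topologicalType) :=
  gen_choiceMixin (Prad R Z).

(* Index of the basic open sets O(mu, V_1, ..., V_k, eps):
   (mu, {V_1,...,V_k}, eps). *)
Definition wbase_index (R : realType) (Z : topologicalType) :=
  ((set Z -> \bar R) * set (set Z) * R)%type.

Definition wbase_dom (R : realType) (Z : topologicalType) :
    set (wbase_index R Z) :=
  [set i | [/\ radon_prob i.1.1, finite_set i.1.2,
               (forall V, i.1.2 V -> open V) & 0 < i.2]].

Definition wbase (R : realType) (Z : topologicalType)
    (i : wbase_index R Z) : set (Prad R Z) :=
  [set nu | forall V, i.1.2 V -> (proj1_sig nu V > i.1.1 V - i.2%:E)%E].

HB.instance Definition _ (R : realType) (Z : topologicalType) :=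
  @isSubBaseTopological.Build (Prad R Z) (wbase_index R Z)
    (@wbase_dom R Z) (@wbase R Z).

Definition marginals (R : realType) (X Y : topologicalType)
    (lam : Prad R (X * Y)%type) (p : (Prad R X * Prad R Y)%type) : Prop :=
  (forall A : set X, borel_set A -> proj1_sig p.1 A = proj1_sig lam (fst @^-1` A)) /\
  (forall B : set Y, borel_set B -> proj1_sig p.2 B = proj1_sig lam (snd @^-1` B)).

(* Main.v *)
Require Import Defs.
From HB Require Import structures.
From mathcomp Require Import all_boot all_order all_algebra.
From mathcomp Require Import all_classical all_reals all_analysis.
From mathcomp Require Import measurable_realfun lra.
Set Implicit Arguments. Unset Strict Implicit. Unset Printing Implicit Defensive.
Import Order.TTheory GRing.Theory Num.Theory numFieldNormedType.Exports.
Local Open Scope classical_set_scope.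
Local Open Scope ring_scope.

(**
A neighbourhood of [lam] is given by finitely many inequalities [c < lam V] with
[V] open. Inner regularity replaces each [V] by a finite union of open
rectangles [A j `*` B j]. The sets [A j] cut [X] into finitely many atoms; up to
small mass for the first marginal of [lam], the atoms are compact, hence
separated by disjoint open sets, each lying in the same [A j] as its atom. This
gives a finite Borel partition [E] of [X], and likewise [F] of [Y]. If [mu] and
[nu] are close to the marginals of [lam], each open cell keeps a proportion
[1 - d] of its mass, so a matrix dominating [(1 - d) * lam (E i `*` F j)] with
margins [mu (E i)] and [nu (F j)] exists: add to [(1 - d) * lam (E i `*` F j)]
the normalized product of the remaining margins. Spreading the entries of the
matrix proportionally to the Radon product of [mu] and [nu] on the cells gives
the coupling.

The Radon product is [C |-> \int nu (C_x) dmu(x)]. For open [C] the integrand is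
lower semicontinuous by the tube lemma, and Dynkin's theorem extends
measurability to Borel [C], although Borel sets of [X * Y] need not belong to
the product of the Borel sigma-algebras.
*)

(** * Compact sets and Borel sets *)

Section compactness.
Variable T : topologicalType.
Implicit Types (A B K L : set T) (P : set T -> Prop).

(** The near-covering form of compactness, applied to the membership relation, replaces the
    extraction of finite subcovers. *)
Lemma compact_ind P K : compact K -> P set0 ->
    (forall A B, A `<=` B -> P B -> P A) ->
    (forall A B, P A -> P B -> P (A `|` B)) ->
    (forall x, K x -> exists2 U, nbhs x U & P U) -> P K.
Proof.
move=> /compact_near_coveringP cK P0 Psub PU Ploc.
(* A family belongs to [F] when it contains all supersets of some set with [P], so nearness for [F]
   yields one set with [P] that covers [K]. *)
pose F : set_system (set T) := [set Q | exists2 A, P A & forall B, A `<=` B -> Q B].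
have FF : Filter F.
  split=> [|Q1 Q2 [A PA A1] [B PB B2]|Q1 Q2 Q12 [A PA A1]].
  - by exists set0.
  - exists (A `|` B); first exact: PU.
    move=> C ABC; split; [apply: A1|apply: B2]; apply: subset_trans ABC.
      exact: subsetUl.
    exact: subsetUr.
  - by exists A => // B /A1 /Q12.
have [x Kx|A PA /(_ A) KA] := cK _ F (fun B x => B x) FF.
  have [U Ux PU'] := Ploc x Kx.
  exists (U, [set B | U `<=` B]) => /=; first by split=> //; exists U.
  by move=> [y B] [/= Uy UB]; apply: UB.
by apply: Psub PA; apply: KA.
Qed.

(** Two compact inductions: on [K] against a single point of [L], then on [L] against all of [K]. A
    union on one side is matched by an intersection of open sets on the other. *)
Lemma compact_separation K L : hausdorff_space T -> compact K -> compact L ->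
  K `&` L = set0 ->
  exists U V, [/\ open U, open V, K `<=` U, L `<=` V & U `&` V = set0].
Proof.
rewrite open_hausdorff => hT cK cL KL0.
pose sep A B := exists U V, [/\ open U, open V, A `<=` U, B `<=` V & U `&` V = set0].
have sepC A B : sep A B -> sep B A.
  by move=> [U [V [oU oV AU BV UV]]]; exists V, U; split=> //; rewrite setIC.
have sep0 A : sep set0 A.
  by exists set0, setT; split=> //; [exact: open0|exact: openT|rewrite set0I].
have sepS A B C : A `<=` B -> sep B C -> sep A C.
  move=> AB [U [V [oU oV BU CV UV]]]; exists U, V; split=> //.
  exact: subset_trans BU.
have sepU A B C : sep A C -> sep B C -> sep (A `|` B) C.
  move=> [U [V [oU oV AU CV UV]]] [U' [V' [oU' oV' BU CV' UV']]].
  exists (U `|` U'), (V `&` V'); split=> //.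
  - exact: openU.
  - exact: openI.
  - exact: setUSS.
  - by move=> c Cc; split; [exact: CV|exact: CV'].
  - by rewrite setIUl setIA UV set0I set0U setIC -setIA (setIC V') UV' setI0.
have sepKy y : L y -> sep K [set y].
  move=> Ly; apply: (compact_ind (P := fun A => sep A [set y])) => //.
  - by move=> A B; apply: sepS.
  - by move=> A B; apply: sepU.
  - move=> x Kx; have xy : x != y.
      by apply/eqP => xy; have : (K `&` L) x; [split=> //; rewrite xy|rewrite KL0].
    have [[U V] /= [xU yV] [oU oV /eqP UV]] := hT _ _ xy.
    exists U; first by apply: open_nbhs_nbhs; split=> //; apply/set_mem.
    exists U, V; split=> // z ->; exact/set_mem.
apply/sepC; apply: (compact_ind (P := fun A => sep A K)) => //.
- by move=> A B; apply: sepS.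
- by move=> A B; apply: sepU.
- move=> y /sepKy[U [V [oU oV KU yV UV]]].
  exists V; first by apply: open_nbhs_nbhs; split=> //; apply: yV.
  by exists V, U; split=> //; rewrite setIC.
Qed.

End compactness.

Lemma tychonoff_hausdorff (R : realType) (Z : topologicalType) :
  tychonoff_space R Z -> hausdorff_space Z.
Proof.
move=> [accZ tyZ]; rewrite open_hausdorff => x y xy.
have cy : closed [set y].
  exact: accessible_closed_set1.
have [f [cf f01 fx fy]] := tyZ x _ cy (fun e : x = y => elimN eqP xy e).
exists (f @^-1` [set t | t < 2^-1], f @^-1` [set t | 2^-1 < t]) => /=.
  split; rewrite inE /=; first by rewrite fx invr_gt0.
  by rewrite fy// invf_lt1 // ltr1n.
split.
- by apply: open_comp => [z _|]; [exact: cf|exact: open_lt].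
- by apply: open_comp => [z _|]; [exact: cf|exact: open_gt].
- by apply/eqP; rewrite -subset0 => z [/= fz /(lt_trans fz)]; rewrite ltxx.
Qed.

Lemma hausdorff_prod (X Y : topologicalType) :
  hausdorff_space X -> hausdorff_space Y -> hausdorff_space (X * Y)%type.
Proof.
move=> hX hY [x y] [x' y'] cl.
congr pair.
  apply: hX => A B Ax Bx.
  have [[u v] [/= Au Bu]] := cl (fst @^-1` A) (fst @^-1` B) 
    (@cvg_fst _ _ _ _ _ _ Ax) (@cvg_fst _ _ _ _ _ _ Bx).
  by exists u.
apply: hY => A B Ax Bx.
have [[u v] [/= Au Bu]] := cl (snd @^-1` A) (snd @^-1` B) 
    (@cvg_snd _ _ _ _ _ _ Ax) (@cvg_snd _ _ _ _ _ _ Bx).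
by exists v.
Qed.

(** * Borel sets, and Radon measures as measures on them *)

Section borel.
Variable Z : topologicalType.

Lemma borel_open (A : set Z) : open A -> borel_set A.
Proof. by move=> oA; rewrite /borel_set; exact: sub_sigma_algebra. Qed.

Lemma borel_setC (A : set Z) : borel_set A -> borel_set (~` A).
Proof. by move=> bA; rewrite -setTD; apply: sigma_algebraCD. Qed.

Lemma borel_closed (A : set Z) : closed A -> borel_set A.
Proof.
by move=> cA; rewrite -[A]setCK; apply: borel_setC; apply: borel_open; exact: closed_openC.
Qed.

Lemma borel_compact (K : set Z) : hausdorff_space Z -> compact K -> borel_set K.
Proof. by move=> hZ cK; apply: borel_closed; exact: compact_closed. Qed.

End borel.

Lemma borel_preimage (Z Z' : topologicalType) (f : Z -> Z') (A : set Z') :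
  continuous f -> borel_set A -> borel_set (f @^-1` A).
Proof.
move=> cf; apply: (smallest_sub (C := sigma_algebra setT) (X := [set A | borel_set (f @^-1` A)])).
  split=> /=.
  - by rewrite preimage_set0; exact: sigma_algebra0.
  - by move=> B bB; rewrite setTD preimage_setC; apply: borel_setC.
  - by move=> F bF; rewrite preimage_bigcup; apply: sigma_algebra_bigcup.
by move=> B oB /=; apply: borel_open; apply: open_comp.
Qed.

(* [measurableType] requires a point, hence the extra parameter. *)
Definition borelT (Z : topologicalType) (z0 : Z) : Type := Z.

Section borelT.
Variables (Z : topologicalType) (z0 : Z).
HB.instance Definition _ := Choice.copy (borelT z0) Z.
HB.instance Definition _ := isPointed.Build (borelT z0) z0.
HB.instance Definition _ := @isMeasurable.Build (sigma_display (@open Z))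
  (borelT z0) (@borel_set Z) (@sigma_algebra0 _ setT _) (@borel_setC Z)
  (@sigma_algebra_bigcup _ setT _).
End borelT.

Lemma borel_setX (X Y : topologicalType) (A : set X) (B : set Y) :
  borel_set A -> borel_set B -> borel_set (A `*` B).
Proof.
move=> bA bB; have [->|/set0P[z0 _]] := eqVneq (A `*` B) set0.
  exact: sigma_algebra0.
have -> : A `*` B = fst @^-1` A `&` snd @^-1` B by [].
apply: (@measurableI _ (borelT z0)); apply: borel_preimage => // z.
  exact: cvg_fst.
exact: cvg_snd.
Qed.

(** The function underlying [mu], retyped on [borelT z0] so that it can carry the structure of a
    probability measure. *)
Definition radon_measure (R : realType) (Z : topologicalType) (z0 : Z)
  (mu : Prad R Z) : set (borelT z0) -> \bar R := proj1_sig mu.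

Arguments radon_measure {R Z} z0 mu A.

Section radon_measure.
Variables (R : realType) (Z : topologicalType) (z0 : Z) (mu : Prad R Z).
Local Notation m := (radon_measure z0 mu).

Let m0 : m set0 = 0%E.
Proof. by case: (proj2_sig mu) => _ []. Qed.

Let m_ge0 A : (0 <= m A)%E.
Proof.
case: (proj2_sig mu) => h [h0 _ _ _ _].
(* Non-negativity is asked of every set; off the Borel sets it comes from the normalization to 0. *)
by case: (pselect (borel_set A)) => [/h0//|/h mA]; rewrite /radon_measure mA.
Qed.

Let m_sigma : semi_sigma_additive m.
Proof. by move=> F mF tF _; case: (proj2_sig mu) => _ [_ _ + _ _]; apply. Qed.

HB.instance Definition _ := isMeasure.Build _ _ _ m m0 m_ge0 m_sigma.

Let mT : m setT = 1%E.
Proof. by case: (proj2_sig mu) => _ []. Qed.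

HB.instance Definition _ := Measure_isProbability.Build _ _ _ m mT.

Lemma radon_measure_gt (A : set (borelT z0)) (c : \bar R) : measurable A ->
  (c < m A)%E -> exists K, [/\ compact (K : set Z), K `<=` A & (c < m K)%E].
Proof.
move=> mA; case: (proj2_sig mu) => _ [_ _ _ _ /(_ A mA)]; rewrite /radon_measure.
by move=> -> /ereal_sup_gt[_ [K [cK KA] <-] cK']; exists K.
Qed.

End radon_measure.

(** * Inner regularity *)

Section inner_regular.
Variables (R : realType) (Z : topologicalType) (z0 : Z).
Hypothesis hZ : hausdorff_space Z.
Variable m : probability (borelT z0) R.
Implicit Types A B K : set Z.

(** Bounding the mass of the difference, instead of taking a supremum, lets errors add up over
    unions and intersections. *)
Definition inner_regular A := forall e : R, 0 < e ->
  exists K, [/\ compact K, K `<=` A & (m (A `\` K) < e%:E)%E].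

Let le_m A B : borel_set A -> borel_set B -> A `<=` B -> (m A <= m B)%E.
Proof. by move=> bA bB AB; apply: le_measure; rewrite ?inE. Qed.

Let measurable_compact K : compact K -> measurable (K : set (borelT z0)).
Proof. exact: borel_compact. Qed.

Lemma inner_regular0 : inner_regular set0.
Proof.
by move=> e e0; exists set0; split=> //; [exact: compact0|rewrite set0D measure0].
Qed.

Lemma inner_regularU A B : borel_set A -> borel_set B ->
  inner_regular A -> inner_regular B -> inner_regular (A `|` B).
Proof.
move=> mA mB rA rB e e0; have e20 : 0 < e / 2 by rewrite divr_gt0.
have [K [cK KA mK]] := rA _ e20; have [L [cL LB mL]] := rB _ e20.
have mK' := measurable_compact cK; have mL' := measurable_compact cL.
exists (K `|` L); split; [exact: compactU|exact: setUSS|].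
have mAK : measurable (A `\` K : set (borelT z0)) by apply: measurableD.
have mBL : measurable (B `\` L : set (borelT z0)) by apply: measurableD.
apply: (@le_lt_trans _ _ (m ((A `\` K) `|` (B `\` L)))).
  apply: le_m.
  - by apply: (@measurableD _ (borelT z0)); apply: measurableU.
  - exact: (@measurableU _ (borelT z0)).
  - by move=> x [[Ax|Bx] /not_orP[nK nL]]; [left|right].
apply: le_lt_trans (measureU2 _ mAK mBL) _.
by rewrite (splitr e) EFinD; apply: lteD.
Qed.

(** Compactness is lost in countable unions: continuity from above first reduces to a finite union
    at a cost of [e / 2], and the finite union is regular within the other half. *)
Lemma inner_regular_bigcup (F : nat -> set Z) : (forall n, borel_set (F n)) ->
  (forall n, inner_regular (F n)) -> inner_regular (\bigcup_n F n).
Proof.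
move=> mF rF e e0; have e20 : 0 < e / 2 by rewrite divr_gt0.
pose S n := \big[setU/set0]_(k < n) F k.
have mS n : measurable (S n : set (borelT z0)) by apply: bigsetU_measurable => k _; exact: mF.
have rS n : inner_regular (S n).
  elim: n => [|n IH]; first by rewrite /S big_ord0; apply: inner_regular0.
  rewrite /S big_ord_recr; apply: inner_regularU => //; exact: (mS n).
have mFoo : measurable (\bigcup_n F n : set (borelT z0)).
  exact: bigcupT_measurable.
pose D n : set (borelT z0) := (\bigcup_n F n) `\` S n.
have mD n : measurable (D n) by apply: measurableD.
have : m \o D @ \oo --> m (\bigcap_n D n).
  apply: nonincreasing_cvg_mu => //.
  - by rewrite (le_lt_trans (probability_le1 _ _))// ltry.
  - exact: bigcapT_measurable.
  - move=> n p np; apply/subsetPset; apply: setDS.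
    exact: (@subset_bigsetU _ F n p np).
have -> : \bigcap_n D n = set0.
  rewrite -subset0 => x Dx; have [[n _ Fx] _] := Dx 0%N I.
  have [_] := Dx n.+1 I; apply; rewrite /S big_ord_recr; by right.
rewrite measure0 => Dcvg.
have [N _ /(_ N (leqnn N)) /= mDN] : \forall n \near \oo, (m (D n) < (e / 2)%:E)%E.
  by apply: (Dcvg [set y | (y < (e / 2)%:E)%E]); apply: open_nbhs_nbhs; split=> //=; exact: open_ereal_lt_ereal.
have [K [cK KS mK]] := rS N _ e20.
have mK' := measurable_compact cK.
have SF : S N `<=` \bigcup_n F n.
  by rewrite /S -bigcup_mkord; apply: bigcup_subset.
exists K; split=> //; first exact: subset_trans SF.
have mSK : measurable (S N `\` K : set (borelT z0)) by apply: measurableD.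
apply: (@le_lt_trans _ _ (m (D N `|` (S N `\` K)))).
  apply: le_m.
  - exact: (@measurableD _ (borelT z0)).
  - exact: (@measurableU _ (borelT z0)).
  - by move=> x [Fx nK]; have [Sx|nSx] := pselect (S N x); [right|left].
apply: le_lt_trans (measureU2 _ (mD N) mSK) _.
by rewrite (splitr e) EFinD; apply: lteD.
Qed.

(** The errors [e / 2 / 2 ^ n.+1] add up to at most [e / 2], and an intersection of compact sets is
    a closed subset of [K 0]. *)
Lemma inner_regular_bigcap (F : nat -> set Z) : (forall n, borel_set (F n)) ->
  (forall n, inner_regular (F n)) -> inner_regular (\bigcap_n F n).
Proof.
move=> mF rF e e0; have e20 : 0 < e / 2 by rewrite divr_gt0.
have en n : 0 < e / 2 / (2 ^ n.+1)%:R by rewrite divr_gt0// ltr0n expn_gt0.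
have /choice[K HK] n : exists K, [/\ compact K, K `<=` F n &
    (m (F n `\` K) < (e / 2 / (2 ^ n.+1)%:R)%:E)%E] by apply: rF.
have mK n : measurable (K n : set (borelT z0)).
  by apply: measurable_compact; case: (HK n).
exists (\bigcap_n K n); split.
- apply: (@subclosed_compact _ _ (K 0%N)).
  + by apply: closed_bigI => n _; apply: compact_closed => //; case: (HK n).
  + by case: (HK 0%N).
  + by move=> x /(_ 0%N I).
- by move=> x Kx n _; have [_ KF _] := HK n; apply/KF/Kx.
have mFK n : measurable (F n `\` K n : set (borelT z0)) by apply: measurableD; [exact: mF|exact: mK].
apply: (@le_lt_trans _ _ (\sum_(n <oo) m (F n `\` K n))%E).
  apply: (@measure_sigma_subadditive _ _ _ m _ (fun n => F n `\` K n)) => //.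
    by apply: (@measurableD _ (borelT z0)); apply: bigcapT_measurable.
  move=> x [Fx /existsNP[n /not_implyP[_ nK]]]; exists n => //; split=> //.
  exact: Fx.
apply: (@le_lt_trans _ _ (\sum_(n <oo) (e / 2 / (2 ^ n.+1)%:R)%:E)%E).
  by apply: lee_nneseries => [//|n _]; have [_ _ /ltW] := HK n.
apply: (le_lt_trans (@epsilon_trick0 _ _ xpredT _)); first exact: ltW.
by rewrite lte_fin; lra.
Qed.

(** Regularity does not obviously pass to complements, so the sigma-algebra considered consists of
    the sets that are regular together with their complement. *)
Lemma borel_inner_regular : (forall V, open V -> inner_regular V) ->
  forall A, borel_set A -> inner_regular A.
Proof.
move=> rO A bA.
suff [] : [set A | [/\ borel_set A, inner_regular A & inner_regular (~` A)]] A by [].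
move: A bA; apply: smallest_sub.
  split=> /=.
  - split; [exact: sigma_algebra0|exact: inner_regular0|rewrite setC0].
    by apply: rO; exact: openT.
  - move=> A [bA rA rA']; rewrite setTD setCK; split=> //.
    exact: borel_setC.
  - move=> F HF; have bF n : borel_set (F n) by case: (HF n).
    split; first exact: sigma_algebra_bigcup.
      by apply: inner_regular_bigcup => // n; case: (HF n).
    rewrite setC_bigcup; apply: inner_regular_bigcap => n; last by case: (HF n).
    exact: borel_setC.
move=> V oV /=; split; [exact: borel_open|exact: rO|].
(* For the complement of [V], intersect it with a compact set that exhausts the whole space up to
   [e]. *)
move=> e e0; have [K [cK _ mK]] := rO _ openT e e0.
exists (K `&` ~` V); split; [|by move=> x []|].
  by apply: compact_closedI => //; exact: open_closedC.
apply: le_lt_trans mK; apply: le_m.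
- apply: (@measurableD _ (borelT z0)).
    by apply: borel_setC; exact: borel_open.
  apply: measurableI; first exact: measurable_compact.
  by apply: borel_setC; exact: borel_open.
- by apply: (@measurableD _ (borelT z0)) => //; exact: measurable_compact.
- by move=> x [nV nK]; split=> // Kx; apply: nK.
Qed.

End inner_regular.

(** * Radon product of two measures *)

(** If every level set were null, so would be their union over rational levels. Off this union
    [g <= f], since a rational fits between [f x] and a larger [g x], and the integrals would
    compare the other way. *)
Lemma lt_integral_level (R : realType) (d : measure_display)
    (T : measurableType d) (mu : {measure set T -> \bar R}) (f g : T -> \bar R) :
  measurable_fun setT f -> measurable_fun setT g ->
  (forall x, 0 <= f x)%E -> (forall x, 0 <= g x)%E ->
  (\int[mu]_x f x < \int[mu]_x g x)%E ->
  exists t : R, (0 < mu [set x | f x <= t%:E < g x])%E.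
Proof.
move=> mf mg f0 g0; apply: contraPP => /forallNP mu0.
apply/negP; rewrite -leNgt.
pose A t := [set x | f x <= t%:E < g x]%E.
have mA t : measurable (A t).
  have -> : A t = [set x | f x <= t%:E]%E `&` [set x | t%:E < g x]%E.
    by apply/seteqP; split=> x /=; [move=> /andP[]|move=> [a b]; apply/andP].
  apply: measurableI; rewrite -[X in measurable X]setTI.
    exact: emeasurable_fun_infty_c.
  exact: emeasurable_fun_o_infty.
have {}mu0 t : mu (A t) = 0%E.
  by apply/eqP; rewrite eq_le measure_ge0 andbT leNgt; apply/negP/mu0.
(* Enumeration of the rationals; numbers that code no rational are sent to 0. *)
pose q n : R := ratr (odflt 0 (unpickle n)).
have nA : mu.-negligible (\bigcup_n A (q n)).
  by apply: negligible_bigcup => n; exists (A (q n)); split.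
apply: ae_ge0_le_integral => //; apply: negligibleS nA => x /=.
move=> /not_implyP[_ /negP]; rewrite -ltNge => gf.
have [r] : exists r : rat, (f x <= (ratr r)%:E < g x)%E; last first.
  by exists (pickle r) => //; rewrite /A/= /q pickleK.
have fx : f x \is a fin_num by rewrite ge0_fin_numE// (lt_le_trans gf)// leey.
move: gf; rewrite -(fineK fx); case: (g x) (g0 x) => [s _|_ _|//].
  rewrite lte_fin => /rat_in_itvoo[r]; rewrite in_itv/= => /andP[r1 r2].
  by exists r; rewrite lee_fin lte_fin r2 ltW.
have [r] : exists r, ratr r \in `](fine (f x)), (fine (f x) + 1)[.
  by apply: rat_in_itvoo; rewrite ltrDl.
by rewrite in_itv/= => /andP[r1 _]; exists r; rewrite lee_fin ltry ltW.
Qed.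

Section product.
Variables (R : realType) (X Y : topologicalType) (x0 : X) (y0 : Y).
Hypotheses (hX : hausdorff_space X) (hY : hausdorff_space Y).
Variables (mu : Prad R X) (nu : Prad R Y).
Local Notation m1 := (radon_measure x0 mu).
Local Notation m2 := (radon_measure y0 nu).
Local Notation slice C x := (pair x @^-1` C).

Lemma continuous_pair (x : X) : continuous (pair x : Y -> X * Y).
Proof. by move=> y; apply: cvg_pair; [exact: cvg_cst|exact: cvg_id]. Qed.

Lemma measurable_slice (C : set (X * Y)) x : borel_set C ->
  measurable (slice C x : set (borelT y0)).
Proof. by apply: borel_preimage; exact: continuous_pair. Qed.

Lemma tube (V : set (X * Y)) x (L : set Y) : open V -> compact L ->
  L `<=` slice V x -> \forall x' \near x, L `<=` slice V x'.
Proof.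
move=> oV /compact_near_coveringP cL LV; apply: cL => y /LV Vxy.
have [[/= A B] [xA yB] AB] : nbhs (x, y) V by apply: open_nbhs_nbhs.
by exists (B, A) => //= -[y' x'] [/= By Ax]; apply: (AB (x', y')).
Qed.

(** A compact part of the slice at [x] with mass above [t] stays, by the tube lemma, inside the
    slices at nearby points. *)
Lemma open_slice_gt (V : set (X * Y)) (t : \bar R) : open V ->
  open [set x | (t < m2 (slice V x))%E].
Proof.
move=> oV; rewrite openE => x /= tV.
have [L [cL LV tL]] := radon_measure_gt (measurable_slice x (borel_open oV)) tV.
rewrite /interior; apply: filterS (tube oV cL LV) => x' LV' /=.
apply: (lt_le_trans tL); apply: le_measure => //; rewrite inE.
  exact: borel_compact.
exact: measurable_slice (borel_open oV).
Qed.

(** Open sets are stable under intersection, so it is enough that the sets with measurable slice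
    mass form a Dynkin system; differences use that [m2] is finite. *)
Lemma measurable_fun_slice (C : set (X * Y)) : borel_set C ->
  measurable_fun setT (fun x : borelT x0 => m2 (slice C x)).
Proof.
move=> bC.
suff [] : [set C | borel_set C /\
  measurable_fun setT (fun x : borelT x0 => m2 (slice C x))] C by [].
move: C bC; apply: (@lambda_system_subset _ open _ setT) => //.
- by move=> A B; exact: openI.
- split=> //.
  + split; first exact: borel_open openT.
    by rewrite [X in measurable_fun _ X](_ : _ = cst (m2 setT)).
  + move=> A B BA [bA mA] [bB mB]; split.
      exact: (@measurableD _ (borelT (x0, y0))).
    rewrite [X in measurable_fun _ X](_ : _ =
      (fun x : borelT x0 => m2 (slice A x) - m2 (slice B x))%E).
      exact: emeasurable_funB.
    apply/funext => x; rewrite [slice (_ `\` _) _](_ : _ = slice A x `\` slice B x)//.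
    rewrite measureD//; [|exact: measurable_slice..|].
      by rewrite setIidr// => y; apply: BA.
    by rewrite (le_lt_trans (probability_le1 _ _))// ?ltry//; exact: measurable_slice.
  + move=> F ndF HF; have bF n : borel_set (F n) by case: (HF n).
    split; first exact: sigma_algebra_bigcup.
    apply: (emeasurable_fun_cvg (fun n (x : borelT x0) => m2 (slice (F n) x))).
      by move=> n; case: (HF n).
    move=> x _; rewrite preimage_bigcup.
    apply: (@nondecreasing_cvg_mu _ _ _ m2 (fun n => slice (F n) x)).
    - by move=> n; apply: measurable_slice.
    - by apply: bigcupT_measurable => n; apply: measurable_slice.
    - move=> i j ij; apply/subsetPset; have /subsetPset FF := ndF _ _ ij.
      by move=> y; apply: FF.
- move=> V oV /=; split; first exact: borel_open.
  apply: (measurability _ (ErealGenOInfty.measurableE R)).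
  move=> _ [_ [a ->] <-]; rewrite setTI preimage_itvoy.
  by apply: borel_open; exact: open_slice_gt.
Qed.

(* The unused argument lets the measure structure below, whose additivity
   depends on it, be inferred. *)
Definition radon_product of hausdorff_space Y :=
  fun C : set (borelT (x0, y0)) => (\int[m1]_x m2 (slice C x))%E.

Local Notation pi := (radon_product hY).

Let pi0 : pi set0 = 0%E.
Proof.
by rewrite /radon_product integral0_eq// => x _; rewrite preimage_set0 measure0.
Qed.

Let pi_ge0 C : (0 <= pi C)%E.
Proof. exact: integral_ge0. Qed.

Let pi_sigma : semi_sigma_additive pi.
Proof.
move=> F mF tF _.
rewrite [X in _ --> X](_ : _ = \sum_(n <oo) pi (F n))%E; last first.
  rewrite /radon_product -integral_nneseries//.
    apply: eq_integral => x _; rewrite preimage_bigcup.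
    apply: (@measure_semi_bigcup _ _ _ m2 (fun n => slice (F n) x)).
    - by move=> n; exact: (measurable_slice x (mF n)).
    - by move=> i j _ _ [y Fij]; apply: tF => //; exists (x, y).
    - by apply: bigcupT_measurable => n; exact: (measurable_slice x (mF n)).
  by move=> n; exact: (measurable_fun_slice (mF n)).
exact: is_cvg_nneseries.
Qed.

HB.instance Definition _ := isMeasure.Build _ _ _ pi pi0 pi_ge0 pi_sigma.

Lemma radon_productX (A : set X) (B : set Y) : borel_set A -> borel_set B ->
  pi (A `*` B) = (m1 A * m2 B)%E.
Proof.
move=> bA bB; rewrite /radon_product.
have mA : measurable (A : set (borelT x0)) by [].
transitivity (\int[m1]_x (m2 B * (\1_A x)%:E))%E.
  apply: eq_integral => x _; rewrite indicE.
  have [/set_mem xA|/negP xA] := boolP (x \in A).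
    by rewrite mule1; congr (m2 _); apply/seteqP; split=> y //= -[].
  rewrite mule0 [slice _ _](_ : _ = set0) ?measure0// -subset0 => y [/= Ax _].
  by apply: xA; apply/mem_set.
rewrite ge0_integralZl//.
- by rewrite integral_indic// setIT muleC.
- by apply/measurable_EFinP; apply: measurable_indic.
Qed.

Let piT : pi setT = 1%E.
Proof.
by rewrite -setXTT radon_productX ?probability_setT ?mule1//; exact: borel_open openT.
Qed.

HB.instance Definition _ := Measure_isProbability.Build _ _ _ pi piT.

Let hXY : hausdorff_space (X * Y)%type := hausdorff_prod hX hY.

(** A countable union of compact sets is inner regular, hence approached in mass by compact subsets,
    which again lie in [V]. *)
Let pi_compact_bigcup (V : set (X * Y)) (F : nat -> set (X * Y)) :
  (forall n, compact (F n)) -> (forall n, F n `<=` V) ->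
  (pi (\bigcup_n F n) <= ereal_sup
    [set pi K | K in [set K : set (X * Y) | compact K /\ K `<=` V]])%E.
Proof.
move=> cF FV; set M := ereal_sup _.
have bF n : borel_set (F n) by apply: borel_compact.
have mF : measurable (\bigcup_n F n : set (borelT (x0, y0))).
  exact: bigcupT_measurable.
apply/lee_addgt0Pr => e e0.
have [|K [cK KF mK]] := @inner_regular_bigcup R _ (x0, y0) hXY pi _ bF _ e e0.
  by move=> n {}e {}e0; exists (F n); split=> //; rewrite setDv measure0.
have bK : measurable (K : set (borelT (x0, y0))) by apply: borel_compact.
rewrite (@measureDI _ _ _ pi _ K)// addeC; apply: leeD; last exact: ltW.
rewrite setIidr//; apply: ereal_sup_ubound; exists K => //; split=> //.
by apply: (subset_trans KF) => z [n _ /FV].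
Qed.

(** Around each point of [K0] there is a tube with base [U] and a compact side [L] of mass above
    [t], inside [V]. If every such [U] met [K0] in a null set, compact induction would make [K0]
    null. *)
Lemma radon_product_positive (V : set (X * Y)) (K0 : set X) (t : R) :
  open V -> compact K0 -> (0 < m1 K0)%E ->
  (forall x, K0 x -> (t%:E < m2 (slice V x))%E) ->
  exists K L, [/\ compact K, compact L, K `<=` K0, K `*` L `<=` V &
    ((0 < m1 K) && (t%:E < m2 L))%E].
Proof.
move=> oV cK0 m0 tV.
have mK0 : measurable (K0 : set (borelT x0)) by apply: borel_compact.
suff [U [L [oU cL ULV tL mU]]] : exists U L, [/\ open U, compact L, U `*` L `<=` V,
    (t%:E < m2 L)%E & (0 < m1 (K0 `&` U))%E].
  have mU' : measurable (U : set (borelT x0)) by apply: borel_open.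
  have [|K [cK KU mK]] := radon_measure_gt _ mU; first exact: measurableI.
  exists K, L; split=> //; [by move=> x /KU[]| |by rewrite mK].
  by move=> [x y] [/= /KU[_ Ux] Ly]; apply: ULV.
apply: contrapT => /forallNP H.
have [W [oO K0O]] : exists W, [/\ open W, K0 `<=` W & m1 (K0 `&` W) = 0%E].
  apply: (compact_ind (P := fun A => exists W, [/\ open W, A `<=` W & m1 (K0 `&` W) = 0%E])) => //.
  - by exists set0; split; [exact: open0| |rewrite setI0 measure0].
  - by move=> A B AB [W [oO BO O0]]; exists W; split=> //; apply: subset_trans BO.
  - move=> A B [W [oO AO O0]] [W2 [oP BP P0]]; exists (W `|` W2); split.
    + exact: openU.
    + exact: setUSS.
    + have mO : measurable (K0 `&` W : set (borelT x0)).
        by apply: measurableI => //; apply: borel_open.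
      have mP : measurable (K0 `&` W2 : set (borelT x0)).
        by apply: measurableI => //; apply: borel_open.
      by rewrite setIUr; apply: null_set_setU.
  - move=> x Kx; have bV := measurable_slice x (borel_open oV).
    have [L [cL LV tL]] := radon_measure_gt bV (tV x Kx).
    have [U [oU Ux] UL] : exists2 U, open_nbhs x U & U `<=` [set x1 | L `<=` slice V x1].
      by move: (tube oV cL LV); rewrite /prop_near1 nbhsE.
    exists U; first exact: open_nbhs_nbhs.
    exists U; split=> //; apply/eqP; rewrite eq_le measure_ge0 andbT leNgt.
    apply/negP => mU; apply: (H U); exists L; split=> //.
    by move=> [x' y'] [/= /UL + Ly]; apply.
by rewrite setIidl// => m00; rewrite m00 ltxx in m0.
Qed.

(* Exhaustion: if a countable union [G] of compact subsets of [V] reaching the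
   supremum missed some mass of [V], then [V_x] would have mass above some [t]
   and [G_x] mass at most [t] for [x] in a set of positive measure; a compact
   rectangle over this set then increases the supremum. *)
Lemma radon_product_inner_regular (C : set (X * Y)) : borel_set C ->
  inner_regular pi C.
Proof.
apply: borel_inner_regular => // V oV e e0.
set S := [set pi K | K in [set K : set (X * Y) | compact K /\ K `<=` V]].
have bV := borel_open oV.
have mV : measurable (V : set (borelT (x0, y0))) by [].
have S1 : (ereal_sup S <= 1)%E.
  apply: ge_ereal_sup => _ [K [cK _] <-]; apply: probability_le1.
  exact: borel_compact.
have S0 : (0 <= ereal_sup S)%E.
  apply: ereal_sup_ubound; exists set0; rewrite ?measure0//; split=> //.
  exact: compact0.
have Sfin : ereal_sup S \is a fin_num.
  by rewrite ge0_fin_numE// (le_lt_trans S1)// ltry.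
suff VS : (pi V <= ereal_sup S)%E.
  have [_ [K [cK KV] <-] mK] := ub_ereal_sup_adherent e0 Sfin.
  have bK : measurable (K : set (borelT (x0, y0))) by apply: borel_compact.
  exists K; split=> //; rewrite measureD//.
    rewrite setIidr// lteBlDr ?fin_num_measure//.
    move: mK; rewrite lteBlDr//; rewrite addeC; exact: le_lt_trans.
  by rewrite (le_lt_trans (probability_le1 _ _))// ltry.
rewrite leNgt; apply/negP => SV.
have /choice[D HD] n : exists D : set (X * Y), [/\ compact D, D `<=` V &
    (ereal_sup S - (n.+1%:R^-1)%:E < pi D)%E].
  have n0 : 0 < n.+1%:R^-1 :> R by rewrite invr_gt0.
  have [_ [K [cK KV] <-] mK] := ub_ereal_sup_adherent n0 Sfin.
  by exists K.
have cD n : compact (D n) by case: (HD n).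
have DV n : D n `<=` V by case: (HD n).
have bD n : borel_set (D n) by apply: borel_compact.
pose G := \bigcup_n D n.
have bG : borel_set G by apply: sigma_algebra_bigcup.
have mG : measurable (G : set (borelT (x0, y0))) by [].
have SG : (ereal_sup S <= pi G)%E.
  apply/lee_addgt0Pr => d d0; have [n] := ltr_add_invr d0; rewrite add0r => nd.
  have [_ _] := HD n; rewrite lteBlDr// => /ltW/le_trans; apply.
  apply: leeD; last by rewrite lee_fin ltW.
  apply: le_measure; rewrite ?inE//; [exact: bD|exact: bigcup_sup].
have GS : (pi G <= ereal_sup S)%E by apply: pi_compact_bigcup.
have [|||||t mt] := @lt_integral_level R _ _ m1
    (fun x : borelT x0 => m2 (slice G x)) (fun x => m2 (slice V x)).
- exact: measurable_fun_slice.
- exact: measurable_fun_slice.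
- by [].
- by [].
- exact: le_lt_trans GS SV.
have mP : measurable ([set x | m2 (slice G x) <= t%:E < m2 (slice V x)]%E : set (borelT x0)).
  rewrite [X in measurable X](_ : _ = [set x | m2 (slice G x) <= t%:E]%E `&`
      [set x | t%:E < m2 (slice V x)]%E); last first.
    by apply/seteqP; split=> x /=; [move=> /andP[]|move=> [a b]; apply/andP].
  apply: measurableI; rewrite -[X in measurable X]setTI.
    by apply: emeasurable_fun_infty_c => //; exact: measurable_fun_slice.
  by apply: emeasurable_fun_o_infty => //; exact: measurable_fun_slice.
have [K0 [cK0 K0P mK0]] := radon_measure_gt mP mt.
have [|K [L [cK cL KK0 KLV /andP[mK tL]]]] := radon_product_positive oV cK0 mK0 (t := t).
  by move=> x /K0P/andP[].
have bK : measurable (K : set (borelT x0)) by apply: borel_compact.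
have bL : measurable (L : set (borelT y0)) by apply: borel_compact.
have cKL : compact (K `*` L) by apply: compact_setX.
have bKL : measurable (K `*` L : set (borelT (x0, y0))) by apply: borel_compact.
have bGKL : measurable (G `&` K `*` L : set (borelT (x0, y0))) by apply: measurableI.
(* The level bounds a slice mass at some point of [K]; its sign allows it to be pulled out of the
   integral below. *)
have t0 : 0 <= t.
  have /set0P[x Kx] : K != set0.
    by apply: contraPneq mK => ->; rewrite measure0 ltxx.
  have /K0P/andP[+ _] := KK0 _ Kx; rewrite -lee_fin; exact: le_trans.
(* Over [K] the slices of [G] have mass at most [t], which limits the overlap of [G] with the new
   rectangle. *)
have GKL : (pi (G `&` K `*` L) <= t%:E * m1 K)%E.
  have m1K : measurable_fun setT (fun x : borelT x0 => (\1_K x)%:E : \bar R).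
    by apply/measurable_EFinP; apply: measurable_indic.
  rewrite -[K in leRHS]setIT -(integral_indic m1 measurableT bK) -ge0_integralZl//.
  apply: ge0_le_integral => //; [exact: measurable_fun_slice|exact: measurable_funeM|].
  move=> x _; rewrite indicE; have [/set_mem xK|/negP xK] := boolP (x \in K).
    have /K0P/andP[+ _] := KK0 _ xK; rewrite mule1; apply: le_trans.
    apply: le_measure; rewrite ?inE; [exact: measurable_slice..|].
    by move=> y [].
  rewrite mule0 [slice _ _](_ : _ = set0) ?measure0// -subset0 => y [_ [/= Kx _]].
  by apply: xK; apply/mem_set.
(* Joining the rectangle to every [D n] gives compact subsets of [V] again. Yet the mass of the
   union is at least the supremum plus [m1 K * (m2 L - t)], a contradiction. *)
have : (pi (G `|` K `*` L) <= ereal_sup S)%E.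
  rewrite /G -bigcupUl; last by exists 0%N.
  apply: pi_compact_bigcup => n; first exact: compactU.
  by rewrite subUset.
rewrite (@measureUfinr _ _ _ pi)//; last first.
  by rewrite (le_lt_trans (probability_le1 _ _))// ltry.
move: GKL tL mK SG; rewrite /= radon_productX//.
rewrite -(fineK Sfin) -(fineK (fin_num_measure m1 _ bK)) -(fineK (fin_num_measure m2 _ bL)).
rewrite -(fineK (fin_num_measure pi _ mG)) -(fineK (fin_num_measure pi _ bGKL)).
rewrite -!EFinM -!EFinD !lee_fin !lte_fin.
move: (fine _) (fine _) (fine _) (fine _) (fine _) => *; nra.
Qed.

End product.

Arguments radon_product {R X Y} x0 y0 mu nu _ C.

(** * Couplings with a prescribed matrix on a partition *)

(** The deficits [u] and [v] of the margins have the same total [1 - theta * W], positive as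
    [theta < 1] and [W <= 1]. Their product divided by this total has margins [u] and [v]. *)
Lemma discrete_coupling (R : realFieldType) (I J : finType) (s : I -> R) (t : J -> R)
    (w : I -> J -> R) (theta : R) :
  0 <= theta < 1 -> (forall i j, 0 <= w i j) -> \sum_i \sum_j w i j <= 1 ->
  \sum_i s i = 1 -> \sum_j t j = 1 ->
  (forall i, theta * \sum_j w i j <= s i) ->
  (forall j, theta * \sum_i w i j <= t j) ->
  exists c : I -> J -> R, [/\ forall i j, theta * w i j <= c i j,
    forall i, \sum_j c i j = s i & forall j, \sum_i c i j = t j].
Proof.
move=> /andP[th0 th1] w0 w1 s1 t1 rs qt.
pose W := \sum_i \sum_j w i j.
have W1 : 0 < 1 - theta * W.
  have : 0 <= W by apply: sumr_ge0 => i _; apply: sumr_ge0.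
  by move=> W0; move: w1; rewrite -/W => w1; nra.
have W0 : 1 - theta * W != 0 by rewrite gt_eqF.
pose u i := s i - theta * \sum_j w i j.
pose v j := t j - theta * \sum_i w i j.
have su : \sum_i u i = 1 - theta * W by rewrite /u sumrB s1 -mulr_sumr.
have sv : \sum_j v j = 1 - theta * W.
  by rewrite /v sumrB t1 -mulr_sumr exchange_big.
exists (fun i j => theta * w i j + u i * v j / (1 - theta * W)); split.
- by move=> i j; rewrite lerDl divr_ge0 ?(ltW W1)// mulr_ge0// subr_ge0.
- move=> i; rewrite big_split /= -mulr_sumr -mulr_suml -mulr_sumr sv mulfK//.
  by rewrite /u; lra.
- move=> j; rewrite big_split /= -mulr_sumr -mulr_suml -mulr_suml su.
  by rewrite mulrAC divff// mul1r /v; lra.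
Qed.

Lemma Prad_of_measure (R : realType) (Z : topologicalType) (z0 : Z)
    (m : {measure set (borelT z0) -> \bar R}) :
  hausdorff_space Z -> m setT = 1%E ->
  (forall A : set Z, borel_set A -> forall e : R, 0 < e ->
    exists K, [/\ compact K, K `<=` A & (m (A `\` K) < e%:E)%E]) ->
  exists lam : Prad R Z, forall A, borel_set A -> proj1_sig lam A = m A.
Proof.
move=> hZ mT rm; pose l A := if `[< borel_set A >] then m A else 0%E.
have lE A : borel_set A -> l A = m A by move=> bA; rewrite /l asboolT.
suff rl : radon_prob l by exists (exist _ l rl).
split=> [A nA|]; first by rewrite /l asboolF.
split.
- by move=> A bA; rewrite lE.
- by rewrite lE ?measure0//; exact: sigma_algebra0.
- move=> F bF tF; rewrite lE; last exact: sigma_algebra_bigcup.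
  rewrite [X in X @ _ --> _](_ : _ = (fun n => \sum_(0 <= k < n) m (F k))%E).
    apply: measure_semi_sigma_additive => //.
    exact: (@bigcupT_measurable _ (borelT z0)).
  by apply/funext => n; apply: eq_bigr => k _; rewrite lE.
- by rewrite lE ?mT//; exact: borel_open openT.
- move=> A bA; rewrite lE//.
  have mA : measurable (A : set (borelT z0)) by [].
  apply/eqP; rewrite eq_le; apply/andP; split; last first.
    apply: ge_ereal_sup => _ [K [cK KA] <-].
    have bK : borel_set K by apply: borel_compact.
    by rewrite lE//; apply: le_measure; rewrite ?inE.
  apply/lee_addgt0Pr => e e0; have [K [cK KA mK]] := rm _ bA e e0.
  have bK : measurable (K : set (borelT z0)) by apply: borel_compact.
  rewrite (measureDI m mA bK) addeC; apply: leeD; last exact: ltW.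
  by rewrite setIidr//; apply: ereal_sup_ubound; exists K; rewrite ?lE.
Qed.

Section step_density.
Variables (R : realType) (d : measure_display) (T : measurableType d).
Variables (m : {measure set T -> \bar R}) (K : finType) (h : K -> {nonneg R}).
Variables (D : K -> set T).
Hypothesis mD : forall k, measurable (D k).

(* As for [radon_product], the unused argument is what makes the measure
   structure inferable. *)
Definition step_density of (forall k, measurable (D k)) := fun C : set T =>
  (\sum_k (h k)%:num%:E * m (C `&` D k))%E.

Let sd0 : (step_density mD) set0 = 0%E.
Proof. by rewrite /step_density big1// => k _; rewrite set0I measure0 mule0. Qed.

Let sd_ge0 C : (0 <= (step_density mD) C)%E.
Proof. by apply: sume_ge0 => k _; apply: mule_ge0. Qed.

Let sd_sigma : semi_sigma_additive (step_density mD).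
Proof.
move=> F mF tF mUF.
rewrite [X in X @ _ --> _](_ : _ = (fun n =>
    \sum_k (h k)%:num%:E * \sum_(0 <= i < n) m (F i `&` D k))%E); last first.
  apply/funext => n; rewrite exchange_big/=; apply: eq_bigr => k _.
  by rewrite ge0_sume_distrr.
apply: cvg_nnesum => k _.
  by near=> n; apply: mule_ge0 => //; apply: sume_ge0.
apply: cvgeZl => //; rewrite setI_bigcupl.
apply: (@measure_semi_sigma_additive _ _ _ m (fun i => F i `&` D k)).
- by move=> i; apply: measurableI.
- by apply: trivIset_setIr.
- by apply: bigcupT_measurable => i; apply: measurableI.
Unshelve. all: by end_near. Qed.

HB.instance Definition _ := isMeasure.Build _ _ _ (step_density mD) sd0 sd_ge0 sd_sigma.

(** The density is bounded by the sum of its coefficients; this bound serves to transfer inner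
    regularity from [m]. *)
Lemma step_density_le (C : set T) : measurable C ->
  (step_density mD C <= (\sum_k (h k)%:num)%:E * m C)%E.
Proof.
move=> mC; rewrite -sumEFin ge0_sume_distrl//.
by apply: lee_sum => k _; apply: lee_wpmul2l => //; apply: measureIl.
Qed.

End step_density.

Arguments step_density {R d T} m {K} h {D} _ C.


Lemma measure_partition (R : realType) (d : measure_display) (T : measurableType d)
    (m : {measure set T -> \bar R}) (K : finType) (D : K -> set T) (A : set T) :
  (forall k, measurable (D k)) -> trivIset setT D -> \bigcup_k D k = setT ->
  measurable A -> m A = (\sum_k m (A `&` D k))%E.
Proof.
move=> mD tD cD mA; rewrite -{1}[A]setIT -cD setI_bigcupr measure_fin_bigcup//.
- rewrite [X in \sum_(k \in X) _](_ : _ = [set` enum K])%E.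
    by rewrite -fsbig_seq ?enum_uniq// big_enum.
  by apply/seteqP; split=> k //= _; rewrite mem_enum.
- exact: finite_finset.
- by move=> i j _ _ [x [[_ Di] [_ Dj]]]; apply: tD => //; exists x.
- by move=> k _; apply: measurableI.
Qed.

Section coupling.
Variables (R : realType) (X Y : topologicalType) (x0 : X) (y0 : Y).
Hypotheses (hX : hausdorff_space X) (hY : hausdorff_space Y).
Variables (mu : Prad R X) (nu : Prad R Y).
Variables (I J : finType) (E : I -> set X) (F : J -> set Y).
Hypotheses (bE : forall i, borel_set (E i)) (bF : forall j, borel_set (F j)).
Hypotheses (tE : trivIset setT E) (tF : trivIset setT F).
Hypotheses (cE : \bigcup_i E i = setT) (cF : \bigcup_j F j = setT).
Local Notation m1 := (radon_measure x0 mu).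
Local Notation m2 := (radon_measure y0 nu).
Local Notation pi := (radon_product x0 y0 mu nu hY).

Let s i := fine (m1 (E i)).
Let t j := fine (m2 (F j)).
Let mE i : measurable (E i : set (borelT x0)) := bE i.
Let mF j : measurable (F j : set (borelT y0)) := bF j.

(** The coupling has density [c i j / (s i * t j)] with respect to the Radon product on the cell of
    index [i, j]. This gives the cell mass [c i j], and the margins of [c] turn into the
    marginals. *)
Lemma exists_coupling (c : I -> J -> R) : (forall i j, 0 <= c i j) ->
  (forall i, \sum_j c i j = s i) -> (forall j, \sum_i c i j = t j) ->
  exists2 lam : Prad R (X * Y)%type, marginals lam (mu, nu) &
    forall (V : set (X * Y)) (P : I -> J -> bool), borel_set V ->
      (forall i j, P i j -> E i `*` F j `<=` V) ->
      ((\sum_i \sum_(j | P i j) c i j)%:E <= proj1_sig lam V)%E.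
Proof.
move=> c0 cs ct.
have hXY := hausdorff_prod hX hY.
have sE i : m1 (E i) = (s i)%:E by rewrite /s fineK// fin_num_measure.
have tE' j : m2 (F j) = (t j)%:E by rewrite /t fineK// fin_num_measure.
have s0 i : 0 <= s i by rewrite -cs sumr_ge0.
have t0 j : 0 <= t j by rewrite -ct sumr_ge0.
have cles i j : c i j <= s i by rewrite -cs (bigD1 j)//= lerDl sumr_ge0.
have clet i j : c i j <= t j by rewrite -ct (bigD1 i)//= lerDl sumr_ge0.
have h0 (k : I * J) : 0 <= c k.1 k.2 / (s k.1 * t k.2) by rewrite divr_ge0// mulr_ge0.
pose h k := NngNum (h0 k).
(* Vanishing margins do no harm: [c i j] lies between 0 and either margin, so it vanishes with
   them. *)
have ht i j : (h (i, j))%:num * t j = c i j / s i.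
  rewrite /=; have [tj|tj] := eqVneq (t j) 0.
    have : c i j = 0 by apply/eqP; rewrite eq_le c0 andbT -tj.
    by move=> ->; rewrite !mul0r.
  by rewrite invfM mulrA mulfVK.
have hs i j : (h (i, j))%:num * s i = c i j / t j.
  rewrite /=; have [si|si] := eqVneq (s i) 0.
    have : c i j = 0 by apply/eqP; rewrite eq_le c0 andbT -si.
    by move=> ->; rewrite !mul0r.
  by rewrite (mulrC (s i)) invfM mulrA mulfVK.
have hst i j : (h (i, j))%:num * (s i * t j) = c i j.
  have [si|si] := eqVneq (s i) 0.
    rewrite si mul0r mulr0; apply/esym/eqP.
    by rewrite eq_le c0 andbT -si.
  by rewrite [s i * _]mulrC mulrA ht mulfVK.
pose D (k : I * J) : set (borelT (x0, y0)) := E k.1 `*` F k.2.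
have mD k : measurable (D k) by apply: borel_setX; [exact: bE|exact: bF].
pose l := step_density pi h mD.
have lE A B : borel_set A -> borel_set B -> l (A `*` B) =
    (\sum_i \sum_j (h (i, j))%:num%:E * (m1 (A `&` E i) * m2 (B `&` F j)))%E.
  move=> bA bB; rewrite /l /step_density pair_big/=; apply: eq_bigr => -[i j] _.
  rewrite -radon_productX; last 2 first.
  - exact: (@measurableI _ (borelT x0)).
  - exact: (@measurableI _ (borelT y0)).
  by rewrite setXI.
have lX (A : set X) : borel_set A -> l (A `*` setT) = m1 A.
  move=> bA; rewrite lE//; last exact: borel_open openT.
  have mA : measurable (A : set (borelT x0)) by [].
  rewrite (measure_partition m1 mE tE cE mA)/=; apply: eq_bigr => i _.
  have mAE : measurable (A `&` E i : set (borelT x0)) by apply: measurableI.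
  have -> : m1 (A `&` E i) = (fine (m1 (A `&` E i)))%:E by rewrite fineK// fin_num_measure.
  have : (fine (m1 (A `&` E i)) <= s i).
    by rewrite /s fine_le ?fin_num_measure//; apply: measureIr.
  have : 0 <= fine (m1 (A `&` E i)) by rewrite fine_ge0.
  move: (fine _) => x xge xle.
  under eq_bigr do rewrite setTI tE' -!EFinM mulrCA ht.
  rewrite sumEFin -mulr_sumr -mulr_suml cs; congr EFin.
  (* In a cell of mass 0 the part [x] cut out by [A] is 0 too. *)
  have [si|si] := eqVneq (s i) 0; last by rewrite divff// mulr1.
  by rewrite si mul0r mulr0; apply/esym/eqP; rewrite eq_le xge andbT -si.
have lY (B : set Y) : borel_set B -> l (setT `*` B) = m2 B.
  move=> bB; rewrite lE//; last exact: borel_open openT.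
  have mB : measurable (B : set (borelT y0)) by [].
  rewrite (measure_partition m2 mF tF cF mB)/= exchange_big/=; apply: eq_bigr => j _.
  have mBF : measurable (B `&` F j : set (borelT y0)) by apply: measurableI.
  have -> : m2 (B `&` F j) = (fine (m2 (B `&` F j)))%:E by rewrite fineK// fin_num_measure.
  have : (fine (m2 (B `&` F j)) <= t j).
    by rewrite /t fine_le ?fin_num_measure//; apply: measureIr.
  have : 0 <= fine (m2 (B `&` F j)) by rewrite fine_ge0.
  move: (fine _) => x xge xle.
  under eq_bigr do rewrite setTI sE -!EFinM mulrA hs mulrC.
  rewrite sumEFin -mulr_sumr -mulr_suml ct; congr EFin.
  have [tj|tj] := eqVneq (t j) 0; last by rewrite divff// mulr1.
  by rewrite tj mul0r mulr0; apply/esym/eqP; rewrite eq_le xge andbT -tj.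
have [||lam lamE] := @Prad_of_measure R _ (x0, y0) (step_density pi h mD) hXY.
- by have := lX _ (borel_open openT); rewrite setXTT probability_setT.
- move=> A bA e e0; pose H := \sum_k (h k)%:num.
  have H0 : 0 <= H by apply: sumr_ge0.
  (* [H] bounds the density; [H + 1] keeps the divisor positive even when [H] is 0. *)
  have [|K [cK KA mK]] := radon_product_inner_regular x0 y0 hX hY mu nu bA (e := e / (H + 1)).
    by rewrite divr_gt0// ltr_wpDl.
  have bK : measurable (K : set (borelT (x0, y0))) by apply: borel_compact.
  have mAK : measurable (A `\` K : set (borelT (x0, y0))) by apply: measurableD.
  exists K; split=> //; apply: le_lt_trans (step_density_le pi h mD mAK) _.
  move: mK; rewrite -/H /=.
  have -> : pi (A `\` K) = (fine (pi (A `\` K)))%:E by rewrite fineK// fin_num_measure.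
  have : 0 <= fine (pi (A `\` K)) by rewrite fine_ge0.
  rewrite -EFinM !lte_fin ltr_pdivlMr ?ltr_wpDl//.
  by move: (fine _) => x xge; nra.
exists lam.
  split=> [A bA|B bB] /=; rewrite lamE.
  - rewrite -[LHS](lX A bA) /l; congr step_density.
    by apply/seteqP; split=> z //= [].
  - by apply: borel_preimage => // z; exact: cvg_fst.
  - rewrite -[LHS](lY B bB) /l; congr step_density.
    by apply/seteqP; split=> z //= [].
  - by apply: borel_preimage => // z; exact: cvg_snd.
move=> V P bV PV; rewrite lamE//= /step_density.
rewrite pair_big_dep/= -sumEFin big_mkcond/=; apply: lee_sum => -[i j] _.
case: ifPn => [/PV EFV|_]; last by apply: mule_ge0 => //; rewrite lee_fin; exact: (h0 (i, j)).
by rewrite setIidr// radon_productX// sE tE' -!EFinM hst.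
Qed.

End coupling.

(** * Open cells and the weak-* topology *)

Section mass.
Variables (R : realType) (Z : topologicalType) (mu : Prad R Z).
Implicit Types A B : set Z.

Definition mass A : R := fine (proj1_sig mu A).

(** On an empty space the total mass would be both 0 and 1. This supplies the point that [borelT]
    takes as a parameter. *)
Lemma Prad_inhabited : inhabited Z.
Proof.
apply: contrapT => nZ; case: (proj2_sig mu) => _ [_ mu0 _ muT _].
have : [set: Z] = set0 by rewrite -subset0 => z _; apply: nZ; constructor.
by move=> T0; move: muT; rewrite T0 mu0 => /eqP; rewrite eqe eq_sym oner_eq0.
Qed.

Lemma massE A : borel_set A -> proj1_sig mu A = (mass A)%:E.
Proof.
case: Prad_inhabited => z0 bA; rewrite /mass fineK//.
exact: (fin_num_measure (radon_measure z0 mu)).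
Qed.

Lemma mass_ge0 A : 0 <= mass A.
Proof.
case: Prad_inhabited => z0.
by rewrite fine_ge0//; exact: (measure_ge0 (radon_measure z0 mu)).
Qed.

Lemma mass_setT : mass setT = 1.
Proof. by rewrite /mass; case: (proj2_sig mu) => _ [_ _ _ -> _]. Qed.

Lemma le_mass A B : borel_set A -> borel_set B -> A `<=` B -> mass A <= mass B.
Proof.
case: Prad_inhabited => z0 bA bB AB; rewrite -lee_fin -!massE//.
by apply: (@le_measure _ _ _ (radon_measure z0 mu)); rewrite ?inE.
Qed.

Lemma mass_le1 A : borel_set A -> mass A <= 1.
Proof. by move=> bA; rewrite -mass_setT le_mass//; exact: borel_open openT. Qed.

Lemma mass_partition (K : finType) (D : K -> set Z) A :
  (forall k, borel_set (D k)) -> trivIset setT D -> \bigcup_k D k = setT ->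
  borel_set A -> mass A = \sum_k mass (A `&` D k).
Proof.
case: Prad_inhabited => z0 bD tD cD bA; apply: EFin_inj; rewrite -massE//.
rewrite -sumEFin; have := @measure_partition R _ _ (radon_measure z0 mu) K D A bD tD cD bA.
move=> /= E; rewrite [LHS]E; apply: eq_bigr => k _; rewrite -massE//.
by apply: (@measurableI _ (borelT z0)); [exact: bA|exact: bD].
Qed.

Lemma massU2 A B : borel_set A -> borel_set B -> mass (A `|` B) <= mass A + mass B.
Proof.
case: Prad_inhabited => z0 bA bB; rewrite -lee_fin EFinD -!massE//.
  exact: (measureU2 (radon_measure z0 mu)).
exact: (@measurableU _ (borelT z0)).
Qed.

Lemma mass_inner_regular A (e : R) : hausdorff_space Z -> borel_set A -> 0 < e ->
  exists K, [/\ compact K, K `<=` A & mass (A `\` K) < e].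
Proof.
case: Prad_inhabited => z0 hZ bA e0.
have [|K [cK KA mK]] := @radon_measure_gt R Z z0 mu A (mass A - e)%:E bA.
  by rewrite /radon_measure massE// lte_fin ltrBlDr ltrDl.
have bK : borel_set K by apply: borel_compact.
have mA : measurable (A : set (borelT z0)) by [].
exists K; split=> //; rewrite -lte_fin -massE; last exact: (@measurableD _ (borelT z0)).
have := measureDI (radon_measure z0 mu) mA bK.
rewrite setIidr//; move: mK; rewrite /= /radon_measure !massE//; last exact: (@measurableD _ (borelT z0)).
by rewrite lte_fin -EFinD => + [] => *; rewrite lte_fin; lra.
Qed.

End mass.

Lemma borel_bigcup_fin (Z : topologicalType) (K : finType) (D : K -> set Z) (P : set K) :
  (forall k, borel_set (D k)) -> borel_set (\bigcup_(k in P) D k).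
Proof.
have [[z0]|nZ] := pselect (inhabited Z).
  move=> bD; apply: (@fin_bigcup_measurable _ (borelT z0)) => [|k _]; last exact: bD.
  exact: finite_finset.
by move=> _; rewrite [X in borel_set X](_ : _ = set0);
  [exact: sigma_algebra0|rewrite -subset0 => z; case: nZ; constructor].
Qed.

Lemma open_forall_fin (Z : topologicalType) (K : finType) (D : K -> set Z) :
  (forall k, open (D k)) -> open [set z | forall k, D k z].
Proof.
move=> oD; rewrite openE => z Dz; rewrite /interior.
by apply: filter_forall => k; apply: open_nbhs_nbhs; split.
Qed.

(* A cell is named by the indices [j] of the sets [A j] containing it; the cell
   named [finset.set0] collects all the points outside the open cells. *)
Lemma exists_open_cells (R : realType) (X : topologicalType) (mu : Prad R X)
    (N : nat) (A : 'I_N -> set X) (e : R) :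
  hausdorff_space X -> (forall j, open (A j)) -> 0 < e ->
  exists E : {set 'I_N} -> set X,
    [/\ forall s, borel_set (E s), trivIset setT E, \bigcup_s E s = setT,
        forall s, s != finset.set0 ->
          open (E s) /\ forall j, j \in s -> E s `<=` A j &
        exists B, [/\ borel_set B, mass mu B < e &
          forall x s, ~ B x -> E s x -> forall j, A j x -> j \in s]].
Proof.
move=> hX oA e0; have [z0] := Prad_inhabited mu.
(* [a x] names the atom containing [x], and [C s] is the atom named [s]: a Borel set, in general not
   open. *)
pose a x : {set 'I_N} := [set j | `[< A j x >]]%SET.
pose C (s : {set 'I_N}) := [set x | a x = s].
have aP x j : reflect (A j x) (j \in a x) by rewrite finset.in_set; apply: asboolP.
have bC s : borel_set (C s).
  have -> : C s = ~` \bigcup_j (if j \in s then ~` A j else A j).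
    apply/seteqP; split=> x /=.
      by move=> <- [j _]; case: ifPn => /aP.
    move=> nx; apply/setP => j; apply/idP/idP => [/aP Ajx|js].
      by apply: contrapT => /negP js; apply: nx; exists j => //; rewrite (negbTE js).
    by apply/aP; apply: contrapT => Ajx; apply: nx; exists j => //; rewrite js.
  apply: borel_setC; apply: borel_bigcup_fin => j; case: ifP => _.
    by apply: borel_setC; exact: borel_open.
  exact: borel_open.
(* The [.+1] makes the sum of the errors over all atoms strictly smaller than [e]. *)
have e'0 : 0 < e / (#|{set 'I_N}|.+1)%:R by rewrite divr_gt0.
have /choice[K HK] s := mass_inner_regular mu hX (bC s) e'0.
have cK s : compact (K s) by case: (HK s).
have KC s : K s `<=` C s by case: (HK s).
have bK s : borel_set (K s) by apply: borel_compact.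
have /choice[UV HUV] : forall st : {set 'I_N} * {set 'I_N}, exists UV : set X * set X,
    st.1 != st.2 -> [/\ open UV.1, open UV.2, K st.1 `<=` UV.1, K st.2 `<=` UV.2 &
      UV.1 `&` UV.2 = set0].
  move=> [s t]; have [->|st] := eqVneq s t; first by exists (set0, set0) => /eqP.
  have [|U [V H]] := compact_separation hX (cK s) (cK t); last by exists (U, V).
  by rewrite -subset0 => x [/KC sx /KC tx]; case/eqP: st; rewrite -sx -tx.
(* [UV (s, t)] and [UV (t, s)] are chosen independently, so [G s] takes from both the side that
   contains [K s]. *)
pose G s := [set x | forall t, s != t -> (UV (s, t)).1 x /\ (UV (t, s)).2 x] `&`
  [set x | forall j, j \in s -> A j x].
have oG s : open (G s).
  apply: openI.
    apply: (open_forall_fin (D := fun t => [set x | s != t -> (UV (s, t)).1 x /\ (UV (t, s)).2 x])).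
    move=> t; have [->|st] := eqVneq s t.
      by rewrite [X in open X](_ : _ = setT); [exact: openT|apply/seteqP; split].
    have [U1 _ _ _ _] := HUV (s, t) st.
    have [_ V1 _ _ _] := HUV (t, s) (contra_neq esym st).
    rewrite [X in open X](_ : _ = (UV (s, t)).1 `&` (UV (t, s)).2); first exact: openI.
    by apply/seteqP; split=> x //= /(_ isT).
  apply: (open_forall_fin (D := fun j => [set x | j \in s -> A j x])) => j.
  have [js|js] := boolP (j \in s).
    by rewrite [X in open X](_ : _ = A j)//; apply/seteqP; split=> x //= /(_ isT).
  by rewrite [X in open X](_ : _ = setT); [exact: openT|apply/seteqP; split].
have KG s : K s `<=` G s.
  move=> x Kx; split=> /= [t st|j js]; last by apply/aP; rewrite (KC _ _ Kx).
  have [_ _ + _ _] := HUV (s, t) st; have [_ _ _ + _] := HUV (t, s) (contra_neq esym st).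
  by move=> /(_ x Kx) ? /(_ x Kx).
have GG s t x : G s x -> G t x -> s = t.
  move=> [Gs _] [Gt _]; apply/eqP; apply: contrapT => /negP st.
  have [_ _ _ _] := HUV (s, t) st; rewrite -subset0 => /(_ x); apply; split.
    by have [] := Gs _ st.
  by have [] := Gt _ (contra_neq esym st).
pose E s := if s == finset.set0 then ~` \bigcup_(t in [set t | t != finset.set0]) G t else G s.
exists E; split.
- move=> s; rewrite /E; case: ifP => _; last exact: borel_open.
  by apply: borel_setC; apply: borel_bigcup_fin => t; exact: borel_open.
- move=> s t _ _ [x []]; rewrite /E; have [->|s0] := eqVneq s finset.set0.
    have [->|t0] := eqVneq t finset.set0 => //.
    by move=> nG Gt; case: nG; exists t.
  have [->|t0] := eqVneq t finset.set0; last exact: GG.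
  by move=> Gs nG; case: nG; exists s.
- apply/seteqP; split=> // x _.
  have [[s s0 Gs]|nG] := pselect ((\bigcup_(t in [set t | t != finset.set0]) G t) x).
    by exists s => //; rewrite /E (negbTE s0).
  by exists finset.set0 => //; rewrite /E eqxx.
- move=> s s0; rewrite /E (negbTE s0); split=> // j js x [_]; exact.
have bCK s : borel_set (C s `\` K s).
  by apply: (@measurableD _ (borelT z0)); [exact: bC|exact: bK].
have bB : borel_set (\bigcup_s (C s `\` K s)) by exact: borel_bigcup_fin.
(* The exceptional set is what the compact cores miss in their atoms. *)
exists (\bigcup_s (C s `\` K s)); split=> //.
  rewrite (@mass_partition R X mu _ C)//; last 2 first.
  - by move=> s t _ _ [x [<- <-]].
  - by apply/seteqP; split=> // x _; exists (a x).
  apply: (@le_lt_trans _ _ (\sum_(s : {set 'I_N}) (e / (#|{set 'I_N}|.+1)%:R))).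
    apply: ler_sum => s _; have [_ _ /ltW] := HK s; apply: le_trans.
    apply: le_mass => //; first by apply: (@measurableI _ (borelT z0)); [exact: bB|exact: bC].
    by move=> x [[t _ [Ct nK]] Cs]; move: nK; rewrite -Ct Cs.
  rewrite sumr_const -[X in X < _]mulr_natr mulrAC ltr_pdivrMr// ltr_pM2l// ltr_nat.
  exact: ltnSn.
move=> x s nB Es j Ajx.
(* Off the exceptional set, [x] lies in the core of its own atom, hence in the open cell named
   [a x]; this name is not empty, as it contains [j]. *)
have Gx : G (a x) x by apply: KG; apply: contrapT => nK; apply: nB; exists (a x).
move: Es; rewrite /E; have [->|s0] := eqVneq s finset.set0.
  case; exists (a x) => //=; apply/eqP => a0.
  by have /aP := Ajx; rewrite a0 finset.in_set0.
by move=> Gs; rewrite (GG _ _ _ Gs Gx); apply/aP.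
Qed.

(** Compact induction: lists are concatenated for a union, and one open rectangle is enough near a
    point. *)
Lemma exists_rectangles (X Y : topologicalType) (K V : set (X * Y)) :
  compact K -> open V -> K `<=` V ->
  exists r : seq (set X * set Y),
    (forall p, p \in r -> open p.1 /\ open p.2) /\
    forall z, K z -> exists2 p, p \in r & (p.1 `*` p.2) z /\ p.1 `*` p.2 `<=` V.
Proof.
move=> cK oV KV.
pose P (A : set (X * Y)) := exists r : seq (set X * set Y),
    (forall p, p \in r -> open p.1 /\ open p.2) /\
    forall z, A z -> exists2 p, p \in r & (p.1 `*` p.2) z /\ p.1 `*` p.2 `<=` V.
apply: (compact_ind (P := P)) => //.
- by exists [::]; split.
- by move=> A B AB [r [or rB]]; exists r; split=> // z /AB/rB.
- move=> A B [r [or rA]] [r' [or' rB]]; exists (r ++ r'); split.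
    by move=> p; rewrite mem_cat => /orP[/or|/or'].
  move=> z [/rA|/rB] [p pr pz]; exists p => //; rewrite mem_cat pr ?orbT//.
- move=> [x y] /KV Vxy.
  have [[/= A B] [xA yB] AB] : nbhs (x, y) V by apply: open_nbhs_nbhs.
  exists (A° `*` B°); first by exists (A°, B°) => //; split; apply/nbhs_interior.
  exists [:: (A°, B°)]; split.
    by move=> p; rewrite mem_seq1 => /eqP->; split; exact: open_interior.
  move=> z ABz; exists (A°, B°); rewrite ?mem_seq1//; split=> // u [/interior_subset ? /interior_subset ?].
  exact: AB.
Qed.

(** * Neighbourhoods in the weak-* topology as lower bounds on open sets *)

Section weak_topology.
Variables (R : realType) (Z : topologicalType).

(** This is the basic open set centred at [mu] for the single set [V], with radius
    [mass mu V - c]. *)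
Lemma Prad_nbhs_gt (mu : Prad R Z) (V : set Z) (c : R) : open V -> c < mass mu V ->
  nbhs mu [set nu : Prad R Z | c < mass nu V].
Proof.
move=> oV cV; have bV := borel_open oV.
pose i : wbase_index R Z := (proj1_sig mu, [set V], mass mu V - c).
have i0 : 0 < mass mu V - c by rewrite subr_gt0.
have Di : wbase_dom i.
  by split=> //=; [exact: (proj2_sig mu)|move=> ? ->].
have oi : open (wbase i).
  exists [set wbase i]; last by rewrite bigcup_set1.
  by move=> _ ->; exact: finI_from1.
have -> : [set nu : Prad R Z | c < mass nu V] = wbase i.
  apply/seteqP; split=> nu /=.
    by move=> cn _ ->; rewrite /= (massE mu bV) (massE _ bV) -EFinB lte_fin; lra.
  by move=> /(_ V erefl); rewrite /= (massE mu bV) (massE _ bV) -EFinB lte_fin => ?; lra.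
apply: open_nbhs_nbhs; split=> // _ /= ->.
by rewrite /= (massE mu bV) -EFinB lte_fin; lra.
Qed.

Lemma Prad_openP (W : set (Prad R Z)) (lam : Prad R Z) : open W -> W lam ->
  exists s : seq (set Z * R),
    (forall p, p \in s -> open p.1 /\ p.2 < mass lam p.1) /\
    forall nu : Prad R Z, (forall p, p \in s -> p.2 < mass nu p.1) -> W nu.
Proof.
move=> [Ws WsD <-] [W' /[dup] WsW' /WsD[D' D'dom W'E] Wlam].
have : forall l : seq (wbase_index R Z), (forall i, i \in l -> wbase_dom i /\ wbase i lam) ->
    exists s : seq (set Z * R),
    (forall p, p \in s -> open p.1 /\ p.2 < mass lam p.1) /\
    forall nu : Prad R Z, (forall p, p \in s -> p.2 < mass nu p.1) ->
      forall i, i \in l -> wbase i nu.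
  elim=> [_|i l IH il]; first by exists [::]; split.
  have [|s [sl sW]] := IH; first by move=> j jl; apply: il; rewrite inE jl orbT.
  have [[ri /finite_seqP[vs vsE] oi i0] ilam] := il i (mem_head _ _).
  pose rho : Prad R Z := exist _ _ ri.
  (* The thresholds come from the centre [rho] of the subbasic set, which need not be [lam]. *)
  exists ([seq (V, mass rho V - i.2) | V <- vs] ++ s); split.
    move=> p; rewrite mem_cat => /orP[/mapP[V Vv ->]|/sl//].
    have iV : i.1.2 V by rewrite vsE.
    have oV := oi _ iV; split=> //=; have := ilam _ iV.
    have := massE rho (borel_open oV); rewrite /= => ->.
    by rewrite (massE lam (borel_open oV)) -EFinB lte_fin.
  move=> nu H j; rewrite inE => /orP[/eqP->|]; last first.
    by apply: sW => p ps; apply: H; rewrite mem_cat ps orbT.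
  move=> V iV; have oV := oi _ iV.
  have := massE rho (borel_open oV); rewrite /= => ->.
  rewrite (massE nu (borel_open oV)) -EFinB lte_fin.
  apply: (H (V, mass rho V - i.2)); rewrite mem_cat; apply/orP; left.
  by apply/mapP; exists V => //; move: iV; rewrite vsE.
move=> /(_ (finmap.enum_fset D'))[i iD'|s [sl sW]].
  by split; [apply/set_mem/D'dom|move: Wlam; rewrite -W'E; apply].
exists s; split=> // nu /sW H; exists W'; first exact: WsW'.
by rewrite -W'E; exact: H.
Qed.

End weak_topology.

(** * Lifting pairs of measures near the marginals *)

Lemma seq_uniform_gap (R : realFieldType) (T : eqType) (s : seq T) (f : T -> R) :
  (forall p, p \in s -> 0 < f p) ->
  exists2 d, 0 < d < 1 & forall p, p \in s -> d < f p.
Proof.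
elim: s => [_|q s IH fs].
  by exists 2^-1 => //; apply/andP; split; lra.
have [|d /andP[d0 d1] ds] := IH; first by move=> p ps; apply: fs; rewrite inE ps orbT.
have fq := fs q (mem_head _ _).
exists (Num.min d (f q / 2)).
  by rewrite lt_min gt_min d0 d1 divr_gt0.
move=> p; rewrite inE gt_min => /orP[/eqP->|/ds->//].
by apply/orP; right; lra.
Qed.

Lemma trivIset_setX (I J X Y : Type) (E : I -> set X) (F : J -> set Y) :
  trivIset setT E -> trivIset setT F ->
  trivIset setT (fun k : I * J => E k.1 `*` F k.2).
Proof.
move=> tE tF [i j] [i' j'] _ _ [[x y] [[/= Ex Fy] [/= Ex' Fy']]].
by congr pair; [apply: tE => //; exists x|apply: tF => //; exists y].
Qed.

(** For a cell of positive mass the bound is strict at [mu] and so persists nearby; for mass 0 it is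
    trivial. *)
Lemma Prad_nbhs_scaled (R : realType) (Z : topologicalType) (mu : Prad R Z)
    (I : finType) (P : pred I) (E : I -> set Z) (d : R) : 0 < d ->
  (forall i, P i -> open (E i)) ->
  nbhs mu [set nu : Prad R Z | forall i, P i -> (1 - d) * mass mu (E i) <= mass nu (E i)].
Proof.
move=> d0 oE.
apply: (@filter_forall _ I (fun i => [set nu : Prad R Z |
  P i -> (1 - d) * mass mu (E i) <= mass nu (E i)]) (nbhs mu) _) => i.
have [Pi|nPi] := boolP (P i); last by apply: filterS filterT => nu _ /= Pi.
have [E0|E0] := eqVneq (mass mu (E i)) 0.
  by apply: filterS filterT => nu _ /= _; rewrite E0 mulr0 mass_ge0.
have {}E0 : 0 < mass mu (E i) by rewrite lt_def E0 mass_ge0.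
have : (1 - d) * mass mu (E i) < mass mu (E i) by nra.
by move=> /(Prad_nbhs_gt (oE _ Pi)); apply: filterS => nu /= /ltW.
Qed.

(** The cells are built from [lam] and its marginals before the nearby pair is given; only the
    matrix depends on that pair. *)
Lemma marginals_nbhs (R : realType) (X Y : topologicalType)
    (lam : Prad R (X * Y)%type) (p : (Prad R X * Prad R Y)%type)
    (s : seq (set (X * Y) * R)) :
  hausdorff_space X -> hausdorff_space Y -> marginals lam p ->
  (forall q, q \in s -> open q.1 /\ q.2 < mass lam q.1) ->
  nbhs p [set p' | exists2 lam' : Prad R (X * Y)%type,
    forall q, q \in s -> q.2 < mass lam' q.1 & marginals lam' p'].
Proof.
move=> hX hY [lamX lamY] sP; have hXY := hausdorff_prod hX hY.
have mX A : borel_set A -> mass lam (fst @^-1` A) = mass p.1 A.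
  by move=> bA; rewrite /mass lamX.
have mY B : borel_set B -> mass lam (snd @^-1` B) = mass p.2 B.
  by move=> bB; rewrite /mass lamY.
have [x0] := Prad_inhabited p.1; have [y0] := Prad_inhabited p.2.
have /choice[K HK] : forall q : set (X * Y) * R, exists K : set (X * Y), q \in s ->
    [/\ compact K, K `<=` q.1 & q.2 < mass lam K].
  move=> q; have [qs|] := boolP (q \in s); last by exists set0.
  have [oq qlam] := sP _ qs; have bq := borel_open oq.
  have [|K [cK Kq mK]] := @radon_measure_gt R _ (x0, y0) lam q.1 q.2%:E bq.
    by rewrite /radon_measure massE.
  exists K => _; split=> //; rewrite -lte_fin -massE//.
  exact: borel_compact.
have bK q : q \in s -> borel_set (K q) by move=> /HK[cK _ _]; exact: borel_compact.
(* The factor 3 pays for two losses: less than [2 * d] on the exceptional strips and at most [d]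
   through the factor [1 - d]. *)
have [|d /andP[d0 d1] Hd] := @seq_uniform_gap R _ s (fun q => (mass lam (K q) - q.2) / 3).
  by move=> q /HK[_ _ qK]; rewrite divr_gt0// subr_gt0.
have /choice[r Hr] : forall q : set (X * Y) * R, exists r : seq (set X * set Y), q \in s ->
    (forall t, t \in r -> open t.1 /\ open t.2) /\
    forall z, K q z -> exists2 t, t \in r & (t.1 `*` t.2) z /\ t.1 `*` t.2 `<=` q.1.
  move=> q; have [qs|] := boolP (q \in s); last by exists [::].
  have [oq _] := sP _ qs; have [cK Kq _] := HK _ qs.
  by have [r Hr] := exists_rectangles cK oq Kq; exists r.
(* One list of rectangles for all the thresholds, so that a single pair of partitions serves them
   all. *)
pose rs := flatten [seq r q | q <- s].
have ors t : t \in rs -> open t.1 /\ open t.2.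
  by move=> /flatten_mapP[q qs]; have [+ _] := Hr _ qs; apply.
pose A (j : 'I_(size rs)) := (nth (set0, set0) rs j).1.
pose B (j : 'I_(size rs)) := (nth (set0, set0) rs j).2.
have KAB q z : q \in s -> K q z -> exists2 j, (A j `*` B j) z & A j `*` B j `<=` q.1.
  move=> qs Kz; have [_ /(_ z Kz)[t tr [tz tq]]] := Hr _ qs.
  have trs : t \in rs by apply/flatten_mapP; exists q.
  have ti : (index t rs < size rs)%N by rewrite index_mem.
  by exists (Ordinal ti); rewrite /A /B /= nth_index.
have oA j : open (A j) by have [] := ors _ (mem_nth (set0, set0) (ltn_ord j)).
have oB j : open (B j) by have [] := ors _ (mem_nth (set0, set0) (ltn_ord j)).
have [E [bE tE cE oE [BX [bBX mBX HBX]]]] := exists_open_cells p.1 hX oA d0.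
have [F [bF tF cF oF [BY [bBY mBY HBY]]]] := exists_open_cells p.2 hY oB d0.
pose I : finType := {set 'I_(size rs)}.
(* Products with a cell named by the empty set are dropped: that cell need not be open, so its mass
   may drop for nearby measures. *)
pose w (i j : I) : R :=
  if (i != finset.set0) && (j != finset.set0) then mass lam (E i `*` F j) else 0.
have bEF i j : borel_set (E i `*` F j) by apply: borel_setX.
have w0 i j : 0 <= w i j by rewrite /w; case: ifP => // _; exact: mass_ge0.
have wle i j : w i j <= mass lam (E i `*` F j).
  by rewrite /w; case: ifP => // _; exact: mass_ge0.
have cF' : \bigcup_j (snd @^-1` F j : set (X * Y)) = setT.
  by rewrite -preimage_bigcup cF.
have cE' : \bigcup_i (fst @^-1` E i : set (X * Y)) = setT.
  by rewrite -preimage_bigcup cE.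
have bpX C : borel_set C -> borel_set (fst @^-1` C : set (X * Y)).
  by apply: borel_preimage => z; exact: cvg_fst.
have bpY D : borel_set D -> borel_set (snd @^-1` D : set (X * Y)).
  by apply: borel_preimage => z; exact: cvg_snd.
have rowE i : \sum_j mass lam (E i `*` F j) = mass p.1 (E i).
  rewrite -mX// (@mass_partition _ _ _ _ (fun j => snd @^-1` F j) (fst @^-1` E i))//.
  - by move=> j; exact: bpY.
  - by move=> j j' _ _ [z Fz]; apply: tF => //; exists z.2.
  - exact: bpX.
have colE j : \sum_i mass lam (E i `*` F j) = mass p.2 (F j).
  rewrite -mY// (@mass_partition _ _ _ _ (fun i => fst @^-1` E i) (snd @^-1` F j))//.
  - by apply: eq_bigr => i _; rewrite setIC.
  - by move=> i; exact: bpX.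
  - by move=> i i' _ _ [z Ez]; apply: tE => //; exists z.1.
  - exact: bpY.
have massE1 (mu : Prad R X) : \sum_i mass mu (E i) = 1.
  rewrite -(mass_setT mu) (mass_partition mu bE tE cE)//; last exact: borel_open openT.
  by apply: eq_bigr => i _; rewrite setTI.
have massF1 (nu : Prad R Y) : \sum_j mass nu (F j) = 1.
  rewrite -(mass_setT nu) (mass_partition nu bF tF cF)//; last exact: borel_open openT.
  by apply: eq_bigr => j _; rewrite setTI.
have row i : \sum_j w i j <= mass p.1 (E i).
  by rewrite -rowE; apply: ler_sum => j _.
have col j : \sum_i w i j <= mass p.2 (F j).
  by rewrite -colE; apply: ler_sum => i _.
have w1 : \sum_i \sum_j w i j <= 1.
  by rewrite -(massE1 p.1); apply: ler_sum.
have nX : nbhs p.1 [set mu : Prad R X | forall i, i != finset.set0 ->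
    (1 - d) * mass p.1 (E i) <= mass mu (E i)].
  by apply: Prad_nbhs_scaled => // i /oE[].
have nY : nbhs p.2 [set nu : Prad R Y | forall j, j != finset.set0 ->
    (1 - d) * mass p.2 (F j) <= mass nu (F j)].
  by apply: Prad_nbhs_scaled => // j /oF[].
exists ([set mu : Prad R X | forall i, i != finset.set0 ->
    (1 - d) * mass p.1 (E i) <= mass mu (E i)],
  [set nu : Prad R Y | forall j, j != finset.set0 ->
    (1 - d) * mass p.2 (F j) <= mass nu (F j)]) => //.
move=> [mu nu] [/= Hmu Hnu].
have [|||c [wc cs ct]] := @discrete_coupling R I I (fun i => mass mu (E i))
  (fun j => mass nu (F j)) w (1 - d) _ w0 w1 (massE1 mu) (massF1 nu).
- by apply/andP; split; lra.
- move=> i; have [i0|i0] := eqVneq i finset.set0.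
    by rewrite big1 ?mulr0 ?mass_ge0// => j _; rewrite /w i0 eqxx.
  apply: le_trans (Hmu i i0); apply: ler_wpM2l => //; lra.
- move=> j; have [j0|j0] := eqVneq j finset.set0.
    by rewrite big1 ?mulr0 ?mass_ge0// => i _; rewrite /w j0 eqxx andbF.
  apply: le_trans (Hnu j j0); apply: ler_wpM2l => //; lra.
have c0 i j : 0 <= c i j by apply: le_trans (wc i j); apply: mulr_ge0 => //; lra.
have [lam' mlam' Hlam'] := @exists_coupling R X Y x0 y0 hX hY mu nu I I E F bE bF
  tE tF cE cF c c0 cs ct.
exists lam' => // q qs.
(* Both cells name a common rectangle inside [q.1], which then contains their product. *)
pose P (i j : I) := [exists k, [&& k \in i, k \in j & `[< A k `*` B k `<=` q.1 >]]].
have [oq _] := sP _ qs; have bq := borel_open oq.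
have P0 i j : P i j -> (i != finset.set0) && (j != finset.set0).
  move=> /existsP[k /and3P[ki kj _]].
  by apply/andP; split; [apply: contraTneq ki|apply: contraTneq kj] => ->; rewrite finset.in_set0.
have PV i j : P i j -> E i `*` F j `<=` q.1.
  move=> Pij; have /andP[i0 j0] := P0 _ _ Pij.
  move: Pij => /existsP[k /and3P[ki kj /asboolP AB]].
  have [_ /(_ k ki) EA] := oE i i0; have [_ /(_ k kj) FB] := oF j j0.
  by apply: subset_trans AB; move=> z [/EA Az /FB Bz].
have := Hlam' _ _ bq PV; rewrite massE// lee_fin; apply: lt_le_trans.
pose bad : set (X * Y) := fst @^-1` BX `|` snd @^-1` BY.
have bbad : borel_set bad.
  by apply: (@measurableU _ (borelT (x0, y0))); [exact: bpX|exact: bpY].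
have mbad : mass lam bad < 2 * d.
  apply: le_lt_trans (massU2 _ (bpX _ bBX) (bpY _ bBY)) _.
  by rewrite mX// mY//; lra.
(* A point of [K q] outside [bad] lies in some rectangle inside [q.1], and the cells of its two
   coordinates both name that rectangle. The masses are compared cell by cell. *)
have Kle : mass lam (K q) <= \sum_i \sum_(j | P i j) mass lam (E i `*` F j) + mass lam bad.
  have cEF : \bigcup_(k : I * I) (E k.1 `*` F k.2) = setT.
    apply/seteqP; split=> // -[x y] _.
    have [i _ Ei] : (\bigcup_i E i) x by rewrite cE.
    have [j _ Fj] : (\bigcup_j F j) y by rewrite cF.
    by exists (i, j).
  have part := @mass_partition R _ lam (I * I)%type (fun k => E k.1 `*` F k.2) _
    (fun k => bEF k.1 k.2) (trivIset_setX tE tF) cEF.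
  rewrite (part _ (bK _ qs)) (part _ bbad) pair_big_dep/= [X in _ <= X + _]big_mkcond/=.
  rewrite -big_split/=; apply: ler_sum => -[i j] _ /=.
  have bI C : borel_set C -> borel_set (C `&` E i `*` F j).
    by move=> bC; apply: (@measurableI _ (borelT (x0, y0))); [exact: bC|exact: bEF].
  case: ifPn => Pij.
    rewrite ler_wpDr ?mass_ge0//; apply: le_mass => //; first exact: bI (bK _ qs).
  rewrite add0r; apply: le_mass; [exact: bI (bK _ qs)|exact: bI|].
  move=> [x y] [Kxy [/= Ex Fy]]; split=> //.
  apply: contrapT => /not_orP[/= nBX nBY].
  have [k [/= Ak Bk] AB] := KAB _ _ qs Kxy.
  case/negP: Pij; apply/existsP; exists k; apply/and3P; split; last exact/asboolP.
    exact: (HBX x).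
  exact: (HBY y).
have Pc : (1 - d) * \sum_i \sum_(j | P i j) mass lam (E i `*` F j)
    <= \sum_i \sum_(j | P i j) c i j.
  rewrite mulr_sumr; apply: ler_sum => i _; rewrite mulr_sumr; apply: ler_sum => j Pij.
  by apply: le_trans (wc i j); rewrite /w P0.
apply: lt_le_trans Pc; have := Hd _ qs; have := mass_le1 lam (bK _ qs).
have := mass_ge0 lam (K q); move: Kle mbad.
move: (\sum_i _) (mass _ _) (mass _ _) => u v k; nra.
Qed.

Theorem theorem1 (R : realType) (X Y : topologicalType) :
  tychonoff_space R X -> tychonoff_space R Y ->
  forall W : set (Prad R (X * Y)%type), open W ->
    open [set p : (Prad R X * Prad R Y)%type |
            exists2 lam, W lam & marginals lam p].
Proof.
move=> /tychonoff_hausdorff hX /tychonoff_hausdorff hY W oW.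
rewrite openE => p [lam Wlam mlam]; rewrite /interior.
have [s [sP sW]] := Prad_openP oW Wlam.
apply: filterS (marginals_nbhs hX hY mlam sP) => p' [lam' Hlam' mlam'].
by exists lam' => //; exact: sW.
Qed.
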